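(* Let $D_+$ and $D_-$ be two connected, checkerboard colorable oriented link diagrams on a closed, connected, oriented surface $\Sigma$ which are identical everywhere except at one crossing, which is positive for $D_+$ and negative for $D_-$. If $\xi$ is a checkerboard coloring for $D_+$ (and $D_-$), then $$\sigma_\xi(D_+)\le\sigma_\xi(D_-)\le\sigma_\xi(D_+)+2.$$ Indeed: (i) if $n_\xi(D_+)=n_\xi(D_-)$, then either $\sigma_\xi(D_-)=\sigma_\xi(D_+)$ or $\sigma_\xi(D_-)=\sigma_\xi(D_+)+2$; (ii) if $n_\xi(D_+)\neq n_\xi(D_-)$, then $\sigma_\xi(D_-)=\sigma_\xi(D_+)+1$.
   Context: A checkerboard coloring $\xi$ of a diagram $D\subset\Sigma$ colors the components of $\Sigma\smallsetminus D$ black/white so that regions sharing an edge have different colors; it depends only on the underlying projection, so $D_+$ and $D_-$ share colorings. The black checkerboard surface is the union of the black regions and one half-twisted band at each crossing. At a crossing $c$, the two strands are the edges of the half-twisted black band at $c$. The incidence number $\eta(c)=\pm1$ is the sign the crossing would have if both strands were oriented to run in the same direction along the band. With the given orientation of the link, $c$ is type II if the two strands run in the same direction along the black band, and type I if in opposite directions. Let $X_0,\dots,X_n$ be the white regions; for $i\ne j$ set $g_{ij}=-\sum\eta(c)$, summed over crossings incident to both $X_i$ and $X_j$, and $g_{ii}=-\sum_{k\ne i}g_{ik}$. The Goeritz matrix is $G_\xi(D)=(g_{ij})_{1\le i,j\le n}$. Let $\mu_\xi(D)=\sum_{c\text{ type II}}\eta(c)$. Then $\sigma_\xi(D)=\operatorname{sig}(G_\xi(D))-\mu_\xi(D)$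 and $n_\xi(D)=\operatorname{nul}(G_\xi(D))$ (independent of the ordering of the white regions). *)

(* Defs.v *)
From HB Require Import structures.
From mathcomp Require Import all_boot all_order all_algebra all_field.

Set Implicit Arguments.
Unset Strict Implicit.
Unset Printing Implicit Defensive.

Import Order.TTheory GRing.Theory Num.Theory.
Local Open Scope ring_scope.

(* The four half-edges at a crossing c are (c, 0), (c, 1), (c, 2), (c, 3) in
   counterclockwise order for the orientation of the surface; (c, i) and
   (c, i + 2) belong to the same strand. *)
Definition half_edge (C : finType) := (C * 'Z_4)%type.

Definition ccw (C : finType) (h : half_edge C) : half_edge C := (h.1, h.2 + 1).
Definition cw (C : finType) (h : half_edge C) : half_edge C := (h.1, h.2 - 1).

(* A 4-valent graph in a closed oriented surface S, up to orientation-preserving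
   homeomorphism.  The rotation at the crossings and the gluing [flip] of
   half-edges into edges determine a regular neighbourhood N of the graph.
   S is obtained from N by gluing in the components of S \ graph: a region is
   a compact connected oriented surface with some of the boundary circles of N
   as boundary, so it is given by this set of circles and its genus.  Regions
   need not be discs.  The set of circles is encoded by [corner]: [corner h] is
   the region containing the angular sector at h.1 between h and [ccw h].
   Travelling from h along its edge one arrives through [flip h], and the side
   on the left is the sector after h at the start and the sector before [flip h]
   at the end; [corner_flip] says that these lie in the same region.
   If the graph is connected and has a crossing, then S is connected. *)
Record projection := Projection {
  crossing : finType;
  flip : half_edge crossing -> half_edge crossing;
  flipK : involutive flip;
  flip_neq : forall h, flip h != h;
  region : finType;
  corner : half_edge crossing -> region;
  corner_flip : forall h, corner h = corner (cw (flip h));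
  corner_surj : forall r, exists h, corner h = r;
  genus : region -> nat
}.

Definition adjacent_crossings (P : projection) : rel (crossing P) :=
  fun c c' => [exists i : 'Z_4, (flip (c, i)).1 == c'].

Definition connected_projection (P : projection) : Prop :=
  forall c c' : crossing P, connect (@adjacent_crossings P) c c'.

(* [outgoing h]: the link orientation at h points away from the crossing h.1. *)
Record diagram (P : projection) := Diagram {
  overstrand : half_edge (crossing P) -> bool;
  overstrand_ccw : forall h, overstrand (ccw h) = ~~ overstrand h;
  outgoing : half_edge (crossing P) -> bool;
  outgoing_strand : forall h, outgoing (ccw (ccw h)) = ~~ outgoing h;
  outgoing_flip : forall h, outgoing (flip h) = ~~ outgoing h
}.

(* The regions on the two sides of the edge through h are [corner h] and
   [corner (cw h)]. *)
Record coloring (P : projection) := Coloring {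
  black : region P -> bool;
  black_edge : forall h, black (corner h) = ~~ black (corner (cw h))
}.

Section Signs.
Variables (P : projection) (D : diagram P).

(* The sign of c when its two strands are oriented by [out]: the crossing is
   positive when a counterclockwise quarter turn takes the direction of the
   overstrand to the direction of the understrand. *)
Definition sign_for (out : half_edge (crossing P) -> bool) (c : crossing P)
    : int :=
  if [exists i : 'Z_4, [&& overstrand D (c, i), out (c, i) & out (ccw (c, i))]]
  then 1 else -1.

Definition crossing_sign : crossing P -> int := sign_for (outgoing D).

Variable xi : coloring P.

(* The black band at c joins the two opposite black sectors at c, and its edges
   are the two strands.  Both strands run in the same direction along the band
   exactly when the two outgoing half-edges bound one of the black sectors. *)
Definition type_II (c : crossing P) : bool :=
  [exists i : 'Z_4, [&& black xi (corner (c, i)), outgoing D (c, i)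
                      & outgoing D (ccw (c, i))]].

Definition band_orientation (h : half_edge (crossing P)) : bool :=
  let k : 'Z_4 := if black xi (corner (h.1, 0)) then 0 else 1 in
  (h.2 == k) || (h.2 == k + 1).

Definition incidence (c : crossing P) : int := sign_for band_orientation c.

Definition mu : int := \sum_(c : crossing P | type_II c) incidence c.

End Signs.

Definition incident (P : projection) (c : crossing P) (r : region P) : bool :=
  [exists i : 'Z_4, corner (c, i) == r].

(* X lists the white regions X_0, ..., X_n without repetition. *)
Definition white_ordering (P : projection) (xi : coloring P) (n : nat)
    (X : 'I_n.+1 -> region P) : Prop :=
  injective X /\ forall r, ~~ black xi r <-> exists i, X i = r.

Section Goeritz.
Variables (P : projection) (D : diagram P) (xi : coloring P).
Variables (n : nat) (X : 'I_n.+1 -> region P).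

Definition goeritz_offdiag (i j : 'I_n.+1) : int :=
  - \sum_(c : crossing P | incident c (X i) && incident c (X j))
      incidence D xi c.

Definition goeritz_entry (i j : 'I_n.+1) : int :=
  if i == j then - \sum_(k < n.+1 | k != i) goeritz_offdiag i k
  else goeritz_offdiag i j.

Definition goeritz : 'M[int]_n :=
  \matrix_(i < n, j < n) goeritz_entry (lift ord0 i) (lift ord0 j).

End Goeritz.

Section Inertia.
Variables (n : nat) (A : 'M[int]_n).

Definition complex_mx : 'M[algC]_n := map_mx intr A.

(* The roots of the characteristic polynomial, with multiplicity. *)
Definition eigenvalues : seq algC :=
  sval (closed_field_poly_normal (char_poly complex_mx)).

Definition mx_signature : int :=
  (count (fun x : algC => 0 < x) eigenvalues)%:Z
  - (count (fun x : algC => x < 0) eigenvalues)%:Z.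

Definition mx_nullity : nat := \rank (kermx complex_mx).

End Inertia.

Definition link_signature (P : projection) (D : diagram P) (xi : coloring P)
    (n : nat) (X : 'I_n.+1 -> region P) : int :=
  mx_signature (goeritz D xi X) - mu D xi.

Definition link_nullity (P : projection) (D : diagram P) (xi : coloring P)
    (n : nat) (X : 'I_n.+1 -> region P) : nat :=
  mx_nullity (goeritz D xi X).

Definition differ_only_at (P : projection) (D D' : diagram P) (c : crossing P)
    : Prop :=
  (forall h, outgoing D h = outgoing D' h) /\
  (forall h, h.1 <> c -> overstrand D h = overstrand D' h).

(* Main.v *)
(** The incidence number is the crossing sign for a crossing of type II and
    its opposite for type I.  Changing [c] from positive to negative therefore
    adds [d u u^T] to the Goeritz matrix, where [u] is the difference of the
    indicators of the two white regions at [c], with [d = -2] and [mu] dropping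
    by 2 in type II, and [d = 2] with [mu] unchanged in type I.  A semidefinite
    perturbation of rank one moves each of the two indices of inertia by at most
    one, monotonically; the nullity tells apart how many of them move.  The
    indices are handled as maximal ranks of definite subspaces, which also gives
    Sylvester's law and hence independence of the ordering of the regions. *)
Require Import Defs.
From HB Require Import structures.
From mathcomp Require Import all_boot all_order all_algebra all_field.
From mathcomp Require Import spectral sesquilinear zify ring.
Set Implicit Arguments.
Unset Strict Implicit.
Unset Printing Implicit Defensive.
Import Order.TTheory GRing.Theory Num.Theory.
Local Open Scope ring_scope.
Local Open Scope sesquilinear_scope.

(** * Indices of inertia of Hermitian forms *)

Section Inertia.
Variable C : numClosedFieldType.

Definition qform n (A : 'M[C]_n) (v : 'rV[C]_n) : C := (v *m A *m v ^t*) 0 0.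

Lemma qformN n (A : 'M[C]_n) v : qform (- A) v = - qform A v.
Proof. by rewrite /qform mulmxN mulNmx mxE. Qed.

Lemma qform_congr m n (M : 'M[C]_(m, n)) (A : 'M[C]_n) v :
  qform (M *m A *m M ^t*) v = qform A (v *m M).
Proof. by rewrite /qform trmx_mul map_mxM !mulmxA. Qed.

Lemma qform_diag n (d : 'rV[C]_n) v :
  qform (diag_mx d) v = \sum_i d 0 i * `|v 0 i| ^+ 2.
Proof.
rewrite /qform mxE; apply: eq_bigr => i _.
by rewrite mul_mx_diag !mxE normCK mulrAC mulrA (mulrC (d 0 i)) mulrAC.
Qed.

Definition posdef_on n (A : 'M[C]_n) m (V : 'M[C]_(m, n)) : Prop :=
  forall v : 'rV[C]_n, (v <= V)%MS -> v != 0 -> 0 < qform A v.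

(** A relation, so that no maximum over subspaces has to be constructed; diagonalisation supplies
    the values. The negative index of [A] is the positive index of [- A]. *)
Definition pos_index n (A : 'M[C]_n) (p : nat) : Prop :=
  (exists V : 'M[C]_n, posdef_on A V /\ \rank V = p) /\
  (forall m (V : 'M[C]_(m, n)), posdef_on A V -> (\rank V <= p)%N).

(** A subspace positive for the pulled-back form meets the kernel of [M] trivially, since that form
    vanishes there. Hence [M] maps it injectively onto a subspace positive for [A]; invertibility of
    [M] is not assumed. *)
Lemma pos_index_congr m n (M : 'M[C]_(m, n)) (A : 'M[C]_n) p q :
  pos_index (M *m A *m M ^t*) p -> pos_index A q -> (p <= q)%N.
Proof.
move=> [[V [Vpos <-]] _] [_ maxq].
have injM : (V :&: kermx M <= (0 : 'M_m))%MS.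
  apply/row_subP => i; set v := row i _.
  have : (v <= V :&: kermx M)%MS by exact: row_sub.
  rewrite sub_capmx => /andP[vV /sub_kermxP vM].
  have [->|v0] := eqVneq v 0; first exact: sub0mx.
  by have := Vpos v vV v0; rewrite qform_congr vM /qform !mul0mx mxE ltxx.
have <- : \rank (V *m M) = \rank V.
  by rewrite -(mxrank_mul_ker V M) [X in (_ + \rank X)%N](submx0null injM)
             mxrank0 addn0.
apply: maxq => _ /submxP[w ->]; rewrite mulmxA => wVM0.
rewrite -qform_congr; apply: Vpos; first exact: submxMl.
by apply: contraNneq wVM0 => ->; rewrite mul0mx.
Qed.

Lemma pos_index_le n (A B : 'M[C]_n) p q : (forall v, qform A v <= qform B v) ->
  pos_index A p -> pos_index B q -> (p <= q)%N.
Proof.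
move=> leAB [[V [Vpos <-]] _] [_ maxq]; apply: maxq => v vV v0.
exact: lt_le_trans (Vpos v vV v0) (leAB v).
Qed.

(** Cutting a [B]-positive subspace with the kernel of [w] costs at most one dimension, and what
    remains is [A]-positive. *)
Lemma pos_index_hyperplane n (A B : 'M[C]_n) (w : 'cV[C]_n) p q :
    (forall v, v *m w = 0 -> qform B v <= qform A v) ->
  pos_index A p -> pos_index B q -> (q <= p.+1)%N.
Proof.
move=> leBA [_ maxp] [[V [Vpos <-]] _].
rewrite -(mxrank_mul_ker V w) -[p.+1]add1n leq_add ?rank_leq_col //.
apply: maxp => v; rewrite sub_capmx => /andP[vV /sub_kermxP vw] v0.
exact: lt_le_trans (Vpos v vV v0) (leBA v vw).
Qed.

(** The rows of [P] with positive weight span a positive subspace. On the span of the other rows the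
    form is nonpositive, so any positive subspace meets it trivially, which bounds its dimension. *)
Lemma pos_index_diag n (P : 'M[C]_n) (d : 'rV[C]_n) :
    P \is unitarymx -> d \is a mxOver Num.real ->
  pos_index (P ^t* *m diag_mx d *m P) #|[pred i | 0 < d 0 i]|.
Proof.
move=> Pu /mxOverP dreal; set S := [pred i | 0 < d 0 i].
pose rows (T : pred 'I_n) : 'M[C]_(#|T|, n) := rowsub enum_val P.
(* The entries of [v *m P ^t*] are the coordinates of [v] in the orthonormal basis of rows of
   [P]. *)
have formE v : qform (P ^t* *m diag_mx d *m P) v
             = \sum_i d 0 i * `|(v *m P ^t*) 0 i| ^+ 2.
  by rewrite -qform_diag -qform_congr trmxCK.
have rowsE (T : pred 'I_n) (v : 'rV_n) i :
    (v <= rows T)%MS -> i \notin T -> (v *m P ^t*) 0 i = 0.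
  move=> /submxP[w ->] iT; rewrite -mulmxA mul_rowsub_mx (unitarymxP _) //.
  rewrite mxE big1 // => j _; rewrite !mxE.
  case: eqP => [ij|_]; last exact: mulr0.
  by rewrite -ij enum_valP in iT.
have rank_rows T : \rank (rows T) = #|T|.
  apply: mxrank_unitary; apply/unitarymxP.
  rewrite /rows trmx_mxsub map_mxsub mul_rowsub_mx.
  apply/matrixP=> i j; rewrite mulmx_colsub (unitarymxP _) // !mxE.
  by rewrite (inj_eq enum_val_inj).
split.
  (* The witness has to be a square matrix, hence the generated subspace. *)
  exists <<rows S>>%MS; split; last by rewrite genmxE rank_rows.
  move=> v; rewrite genmxE => vV v0; rewrite formE lt_neqAle eq_sym.
  have term_ge0 i : 0 <= d 0 i * `|(v *m P ^t*) 0 i| ^+ 2.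
    have [di|di] := boolP (0 < d 0 i).
      by rewrite mulr_ge0 ?exprn_ge0 // ltW.
    by rewrite (rowsE _ _ _ vV) ?normr0 ?expr0n ?mulr0.
  rewrite sumr_ge0 // andbT psumr_eq0 //; apply: contra v0 => /allP allz.
  have : v *m P ^t* = 0.
    apply/rowP => i; rewrite [RHS]mxE.
    have [di|di] := boolP (0 < d 0 i); last exact: rowsE vV _.
    have := allz i (mem_index_enum _); rewrite mulf_eq0 gt_eqF //=.
    by rewrite expf_eq0 normr_eq0 /= => /eqP.
  by move=> /(congr1 (mulmx^~ P)); rewrite mul0mx mulmxKtV // => ->.
move=> m V Vpos.
have := rank_leq_col (V + rows (predC S))%MS.
have cap0 : (V :&: rows (predC S))%MS = 0.
  apply: (submx0null (m2 := n)); apply/row_subP => i; set v := row i _.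
  have : (v <= V :&: rows (predC S))%MS by exact: row_sub.
  rewrite sub_capmx => /andP[vV vS].
  have [->|v0] := eqVneq v 0; first exact: sub0mx.
  suff : qform (P ^t* *m diag_mx d *m P) v <= 0.
    by move/(lt_le_trans (Vpos v vV v0)); rewrite ltxx.
  rewrite formE sumr_le0 // => j _; have [dj|dj] := boolP (0 < d 0 j).
    by rewrite (rowsE _ _ _ vS) ?normr0 ?expr0n ?mulr0 // !inE negbK.
  rewrite mulr_le0_ge0 ?exprn_ge0 //.
  by rewrite real_leNgt.
rewrite mxrank_disjoint_sum // rank_rows -[leqRHS]card_ord -(cardC S).
by rewrite leq_add2r.
Qed.

(** Upper bound: the matrix factors through dimension [#|S|]. Lower bound: its nonzero rows,
    multiplied by the matching columns of the entrywise inverse, give the identity of size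
    [#|S|]. *)
Lemma rank_diag_mx n (d : 'rV[C]_n) :
  \rank (diag_mx d) = #|[pred i | d 0 i != 0]|.
Proof.
set S := [pred i | _]; pose f : 'I_#|S| -> 'I_n := enum_val.
apply/eqP; rewrite eqn_leq; apply/andP; split.
  have -> : diag_mx d = colsub f 1%:M *m rowsub f (diag_mx d).
    apply/matrixP => i j; rewrite !mxE.
    have [iS|iS] := boolP (i \in S); last first.
      have /eqP -> : d 0 i == 0 by move: iS; rewrite inE negbK.
      rewrite mul0rn big1 // => k _; rewrite !mxE.
      case: eqP => [ik|_]; last by rewrite mul0r.
      by rewrite ik enum_valP in iS.
    rewrite (bigD1 (enum_rank_in iS i)) //= !mxE /f enum_rankK_in // eqxx mul1r.
    rewrite big1 ?addr0 // => k ki; rewrite !mxE; case: eqP => [ik|_].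
      by case/eqP: ki; apply: enum_val_inj; rewrite enum_rankK_in.
    by rewrite mul0r.
  exact: leq_trans (mxrankM_maxl _ _) (rank_leq_col _).
have <- : \rank (rowsub f (diag_mx d)
                *m colsub f (diag_mx (map_mx GRing.inv d))) = #|S|.
  rewrite -[RHS](mxrank1 C); congr (\rank _); apply/matrixP => i j.
  rewrite mul_rowsub_mx mulmx_colsub mulmx_diag !mxE (inj_eq enum_val_inj).
  case: eqP => // _.
  by rewrite divff // -[_ != 0]/(f i \in S) enum_valP.
apply: leq_trans (mxrankM_maxl _ _) _.
by rewrite -[X in rowsub f X]mul1mx -mul_rowsub_mx mxrankM_maxr.
Qed.

Lemma char_poly_similar n (P A : 'M[C]_n) : P \in unitmx ->
  char_poly (invmx P *m A *m P) = char_poly A.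
Proof.
move=> Pu; pose Q := map_mx polyC P; pose Q' := map_mx polyC (invmx P).
have QQ : Q' *m Q = 1%:M by rewrite -map_mxM mulVmx // map_mx1.
rewrite /char_poly.
have -> : char_poly_mx (invmx P *m A *m P) = Q' *m char_poly_mx A *m Q.
  rewrite /char_poly_mx mulmxBr mulmxBl mul_mx_scalar -scalemxAl QQ scalemx1.
  by rewrite !map_mxM.
by rewrite !det_mulmx mulrAC -det_mulmx QQ det1 mul1r.
Qed.

(** By the spectral theorem [A] is unitarily diagonal with real entries. The list [s] is left
    arbitrary because [eigenvalues] is only known through the factorisation of the characteristic
    polynomial. *)
Lemma hermitian_inertia n (A : 'M[C]_n) (s : seq C) :
    A \is hermsymmx -> char_poly A = \prod_(x <- s) ('X - x%:P) ->
  [/\ pos_index A (count (fun x => 0 < x)%R s),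
      pos_index (- A) (count (fun x => x < 0) s)
    & (count (fun x => 0 < x)%R s + count (fun x => (x < 0)%R) s
       + \rank (kermx A) = n)%N].
Proof.
move=> Aherm; have Pu := spectral_unitarymx A.
have := hermitian_spectral_diag_real Aherm; have Punit := spectral_unit A.
have /hermitian_normalmx/orthomx_spectralP := Aherm.
set P := spectralmx A in Pu Punit *; set d := spectral_diag A => AE dreal As.
have {As} Es : perm_eq s [seq d 0 i | i <- enum 'I_n].
  apply: prod_XsubC_eq; rewrite -As AE char_poly_similar // char_poly_trig.
    by rewrite big_map big_enum; apply: eq_bigr => i _; rewrite mxE eqxx.
  exact: diag_mx_is_trig.
have countE (a : pred C) : count a s = #|[pred i | a (d 0 i)]|.
  by rewrite (seq.permP Es) count_map -size_filter cardE enumT.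
rewrite !countE; split.
- by rewrite {1}AE invmx_unitary //; apply: pos_index_diag.
- rewrite {1}AE invmx_unitary // -mulNmx -mulmxN -linearN.
  rewrite (eq_card (B := [pred i | 0 < (- d) 0 i])).
    apply: pos_index_diag => //; apply/mxOverP => i j.
    by rewrite mxE rpredN; apply: (mxOverP dreal).
  by move=> i; rewrite !inE mxE oppr_gt0.
have rankA : \rank A = #|[pred i | d 0 i != 0]|.
  rewrite -rank_diag_mx AE mxrankMfree ?row_free_unit //.
  by rewrite eqmxMfull // row_full_unit unitmx_inv.
(* Since the entries are real, the nonzero ones split into positive and negative ones. *)
have -> : #|[pred i | 0 < d 0 i]|
        = #|[predD [pred i | d 0 i != 0] & [pred i | d 0 i < 0]]|.
  apply: eq_card => i; rewrite !inE -real_leNgt ?real0 ?(mxOverP dreal) //.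
  by rewrite lt_neqAle eq_sym andbC.
have -> : #|[pred i | d 0 i < 0]|
        = #|[predI [pred i | d 0 i != 0] & [pred i | d 0 i < 0]]|.
  by apply: eq_card => i; rewrite !inE;
     have [/lt_eqF ->|] := boolP (d 0 i < 0); rewrite ?andbF.
by rewrite [X in (X + _)%N]addnC cardID -rankA mxrank_ker subnKC ?rank_leq_row.
Qed.

End Inertia.

(** * Signature and nullity of symmetric integer matrices *)

Lemma complex_mx_conj m n (A : 'M[int]_(m, n)) :
  (map_mx intr A : 'M[algC]_(m, n)) ^t* = map_mx intr A^T.
Proof. by apply/matrixP => i j; rewrite !mxE rmorph_int. Qed.

(** Trades the eigenvalue counts for indices of inertia, to which congruence and monotonicity
    arguments apply. *)
Lemma symmetric_inertia n (A : 'M[int]_n) : A^T = A ->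
  exists p q : nat,
    [/\ pos_index (complex_mx A) p, pos_index (complex_mx (- A)) q,
        (p + q + mx_nullity A = n)%N & mx_signature A = p%:Z - q%:Z].
Proof.
move=> Asym; have Aherm : complex_mx A \is hermsymmx.
  by apply/is_hermitianmxP; rewrite expr0 scale1r complex_mx_conj Asym.
have Achar : char_poly (complex_mx A)
    = \prod_(x <- eigenvalues A) ('X - x%:P).
  rewrite /eigenvalues; case: closed_field_poly_normal => s /= {1}->.
  by rewrite (monicP (char_poly_monic _)) scale1r.
have [posA negA nulA] := hermitian_inertia Aherm Achar.
do 2!eexists; split; [exact: posA | | exact: nulA | by []].
by rewrite /complex_mx map_mxN.
Qed.

(** Sylvester's law, with two congruences in opposite directions in place of an invertible one: each
    gives one inequality for both indices, and the nullity is the complement of their sum. *)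
Lemma signature_congr n (A B M N : 'M[int]_n) :
    A^T = A -> B = M *m A *m M^T -> A = N *m B *m N^T ->
  mx_signature A = mx_signature B /\ mx_nullity A = mx_nullity B.
Proof.
have complexE (X Y : 'M[int]_n) : complex_mx (X *m Y *m X^T)
    = complex_mx X *m complex_mx Y *m (complex_mx X) ^t*.
  by rewrite complex_mx_conj /complex_mx !map_mxM.
move=> Asym BE AE.
have Bsym : B^T = B by rewrite BE !trmx_mul trmxK Asym mulmxA.
have NBE : - B = M *m (- A) *m M^T by rewrite mulmxN mulNmx -BE.
have NAE : - A = N *m (- B) *m N^T by rewrite mulmxN mulNmx -AE.
have [p [q [pA qA nA ->]]] := symmetric_inertia Asym.
have [p' [q' [pB qB nB ->]]] := symmetric_inertia Bsym.
have le_p : (p <= p')%N.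
  by apply: (pos_index_congr (M := complex_mx N) _ pB); rewrite -complexE -AE.
have le_p' : (p' <= p)%N.
  by apply: (pos_index_congr (M := complex_mx M) _ pA); rewrite -complexE -BE.
have le_q : (q <= q')%N.
  by apply: (pos_index_congr (M := complex_mx N) _ qB); rewrite -complexE -NAE.
have le_q' : (q' <= q)%N.
  by apply: (pos_index_congr (M := complex_mx M) _ qA); rewrite -complexE -NBE.
lia.
Qed.

(** The form grows by [k] times the squared modulus of [v *m w], which vanishes on a hyperplane. So
    the positive index rises by some [a] and the negative one drops by some [b], both 0 or 1. The
    signature changes by [a + b] and the nullity by [b - a]. *)
Lemma signature_rank_one n (A B : 'M[int]_n) (u : 'cV[int]_n) (k : int) :
    A^T = A -> 0 <= k -> B = A + k *: (u *m u^T) ->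
  [/\ mx_signature A <= mx_signature B <= mx_signature A + 2,
      mx_nullity A = mx_nullity B ->
        mx_signature B = mx_signature A \/
        mx_signature B = mx_signature A + 2
    & mx_nullity A <> mx_nullity B -> mx_signature B = mx_signature A + 1].
Proof.
move=> Asym k0 BE.
have Bsym : B^T = B by rewrite BE linearD linearZ /= trmx_mul trmxK Asym.
pose w : 'cV[algC]_n := map_mx intr u.
have formB v : qform (complex_mx B) v
    = qform (complex_mx A) v + k%:~R * `|(v *m w) 0 0| ^+ 2.
  rewrite BE /complex_mx map_mxD map_mxZ map_mxM -complex_mx_conj /qform.
  rewrite mulmxDr mulmxDl mxE; congr (_ + _).
  rewrite -scalemxAr -scalemxAl mxE; congr (_ * _).
  have -> : v *m (w *m w ^t*) *m v ^t* = (v *m w) *m (v *m w) ^t*.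
    by rewrite [(v *m w)^T]trmx_mul map_mxM !mulmxA.
  by rewrite mxE big_ord1 !mxE normCK.
have formNE (X : 'M[int]_n) v :
    qform (complex_mx (- X)) v = - qform (complex_mx X) v.
  by rewrite -qformN /complex_mx map_mxN.
have leAB v : qform (complex_mx A) v <= qform (complex_mx B) v.
  by rewrite formB lerDl mulr_ge0 ?exprn_ge0 // ler0z.
have eqAB v : v *m w = 0 -> qform (complex_mx B) v = qform (complex_mx A) v.
  by move=> vw; rewrite formB vw mxE normr0 expr0n mulr0 addr0.
have [p [q [pA qA nA ->]]] := symmetric_inertia Asym.
have [p' [q' [pB qB nB ->]]] := symmetric_inertia Bsym.
have le_p : (p <= p')%N := pos_index_le leAB pA pB.
have le_p' : (p' <= p.+1)%N.
  by apply: (@pos_index_hyperplane _ _ _ _ w _ _ _ pA pB) => v /eqAB ->.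
have le_q : (q' <= q)%N.
  by apply: (pos_index_le _ qB qA) => v; rewrite !formNE lerN2.
have le_q' : (q <= q'.+1)%N.
  by apply: (@pos_index_hyperplane _ _ _ _ w _ _ _ qB qA) => v /eqAB;
     rewrite !formNE => ->.
split; lia.
Qed.

(** * Local computations at a crossing *)

Lemma exists_Z4 (p : pred 'Z_4) :
  [exists i, p i] = [|| p 0, p 1, p 2 | p 3].
Proof.
apply/existsP/idP => [[[[|[|[|[|//]]]] lt_i]]|].
- by rewrite (_ : Ordinal lt_i = 0) => [->|]; last exact: val_inj.
- by rewrite (_ : Ordinal lt_i = 1) => [->|]; [rewrite orbT | exact: val_inj].
- by rewrite (_ : Ordinal lt_i = 2) => [->|]; [rewrite !orbT | exact: val_inj].
- by rewrite (_ : Ordinal lt_i = 3) => [->|]; [rewrite !orbT | exact: val_inj].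
by case/or4P; eexists; eassumption.
Qed.

Section Crossing.
Variables (P : projection) (xi : coloring P) (c : crossing P).

Lemma ccwE (i : 'Z_4) : ccw (c, i) = (c, i + 1). Proof. by []. Qed.

Lemma black_corner (i : 'Z_4) :
  black xi (corner (c, i + 1)) = ~~ black xi (corner (c, i)).
Proof. by rewrite black_edge /cw /= addrK. Qed.

(* [s] is either [overstrand] or the colour of the sector. *)
Lemma exists_outgoing_sector (s out : half_edge (crossing P) -> bool) :
    (forall h, s (ccw h) = ~~ s h) ->
    (forall i, out (c, i + 1 + 1) = ~~ out (c, i)) ->
  [exists i : 'Z_4, [&& s (c, i), out (c, i) & out (ccw (c, i))]]
  = (s (c, 0) == (out (c, 0) == out (c, 1))).
Proof.
move=> s_ccw out_turn; rewrite exists_Z4 !ccwE.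
have [e1 e2 e3 e4] : [/\ 0 + 1 = 1 :> 'Z_4, 1 + 1 = 2 :> 'Z_4,
    2 + 1 = 3 :> 'Z_4 & 3 + 1 = 0 :> 'Z_4] by split; apply: val_inj.
have := s_ccw (c, 0); have := s_ccw (c, 1); have := s_ccw (c, 2).
rewrite !ccwE; have := out_turn 0; have := out_turn 1.
rewrite !(e1, e2, e3, e4) => -> -> -> -> ->.
by case: (s _); case: (out (c, 0)); case: (out (c, 1)).
Qed.
End Crossing.

Section Signs.
Variables (P : projection) (D : diagram P) (xi : coloring P) (c : crossing P).

Lemma crossing_signE : crossing_sign D c
  = if overstrand D (c, 0) == (outgoing D (c, 0) == outgoing D (c, 1))
    then 1 else -1.
Proof.
rewrite /crossing_sign /sign_for exists_outgoing_sector //; first exact: overstrand_ccw.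
by move=> i; rewrite -outgoing_strand.
Qed.

Lemma incidenceE : incidence D xi c
  = if overstrand D (c, 0) == black xi (corner (c, 0)) then 1 else -1.
Proof.
rewrite /incidence /sign_for exists_outgoing_sector.
(* The half-edges 0 and 1 get the same direction from [band_orientation] exactly when the sector
   between them is black. *)
- by rewrite /band_orientation /=; case: (black xi _); case: overstrand.
- exact: overstrand_ccw.
move=> i; rewrite /band_orientation /=; case: (black xi _);
  by case: i => [[|[|[|[|//]]]] lt_i].
Qed.

Lemma type_IIE : type_II D xi c
  = (black xi (corner (c, 0)) == (outgoing D (c, 0) == outgoing D (c, 1))).
Proof.
rewrite /type_II (@exists_outgoing_sector _ _ (fun h => black xi (corner h))) //.
  by case=> c' i; apply: black_corner.
by move=> i; rewrite -outgoing_strand.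
Qed.

(** Crossing sign, incidence and type each compare two of the same three Booleans: overstrand,
    colour, and agreement of the half-edges 0 and 1. The three comparisons, read as signs, multiply
    to 1. *)
Lemma incidence_sign : incidence D xi c
  = if type_II D xi c then crossing_sign D c else - crossing_sign D c.
Proof.
rewrite incidenceE crossing_signE type_IIE.
by case: (overstrand _ _); case: (black _ _); case: (outgoing _ _ == _).
Qed.

Definition white_sector : 'Z_4 := if black xi (corner (c, 0)) then 1 else 0.

(* [white_side] vanishes when the two white sectors at [c] lie in the same
   region. *)
Definition white_side (r : region P) : int :=
  (r == corner (c, white_sector))%:R - (r == corner (c, white_sector + 2))%:R.

(** Colours alternate around [c], and the two black sectors cannot lie in a white region. *)
Lemma incident_white (r : region P) : ~~ black xi r ->
  incident c r = (r == corner (c, white_sector))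
                 || (r == corner (c, white_sector + 2)).
Proof.
move=> r_white; rewrite /incident exists_Z4.
have neq i : black xi (corner (c, i)) -> (corner (c, i) == r) = false.
  by move=> bi; apply: contraNF r_white => /eqP <-.
have [e1 e2 e3 e4] : [/\ 0 + 1 = 1 :> 'Z_4, 1 + 1 = 2 :> 'Z_4,
    2 + 1 = 3 :> 'Z_4 & 0 + 2 = 2 :> 'Z_4] by split; apply: val_inj.
have e5 : 1 + 2 = 3 :> 'Z_4 by apply: val_inj.
have := black_corner xi c 0; have := black_corner xi c 1.
have := black_corner xi c 2; rewrite !(e1, e2, e3) => b3 b2 b1.
rewrite /white_sector; case: ifP => b0.
  by rewrite e5 (neq 0) ?(neq 2) ?b2 ?b1 ?b0 //= !(eq_sym r).
by rewrite e4 (neq 1) ?(neq 3) ?b3 ?b2 ?b1 ?b0 //= orbF !(eq_sym r).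
Qed.

Lemma white_sector_white : ~~ black xi (corner (c, white_sector))
  /\ ~~ black xi (corner (c, white_sector + 2)).
Proof.
have e : white_sector + 2 = white_sector + 1 + 1.
  by rewrite -addrA; congr (_ + _); apply: val_inj.
rewrite e !black_corner negbK /white_sector.
have := black_corner xi c 0.
rewrite (_ : 0 + 1 = 1 :> 'Z_4); last exact: val_inj.
by case: ifP => [b0 ->|->].
Qed.
End Signs.

(** * Goeritz matrices under reordering of the white regions *)

Section Goeritz.
Variables (P : projection) (xi : coloring P) (n : nat).
Implicit Types (D : diagram P) (X Y : 'I_n.+1 -> region P).

Lemma goeritz_offdiagC D X i j :
  goeritz_offdiag D xi X i j = goeritz_offdiag D xi X j i.
Proof.
by congr (- _); apply: eq_bigl => c; rewrite andbC.
Qed.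

Lemma goeritz_entryC D X i j :
  goeritz_entry D xi X i j = goeritz_entry D xi X j i.
Proof.
rewrite /goeritz_entry (eq_sym j i); have [->//|_] := eqVneq i j.
exact: goeritz_offdiagC.
Qed.

Lemma goeritz_sym D X : (goeritz D xi X)^T = goeritz D xi X.
Proof. by apply/matrixP => i j; rewrite !mxE goeritz_entryC. Qed.

Lemma goeritz_entry_sum D X i : \sum_j goeritz_entry D xi X i j = 0.
Proof.
rewrite (bigD1 i) //= {1}/goeritz_entry eqxx addrC.
rewrite (eq_bigr (goeritz_offdiag D xi X i)) ?subrr // => j ji.
by rewrite /goeritz_entry eq_sym (negPf ji).
Qed.

(* Rows and columns with index 0 are eliminated from the full matrix of
   vanishing row sums by e_0 = - (e_1 + ... + e_n). *)
Definition reindex_mx (s : 'I_n.+1 -> 'I_n.+1) : 'M[int]_n :=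
  \matrix_(i, j) ((s (lift ord0 i) == lift ord0 j)%:R
                  - (s (lift ord0 i) == ord0)%:R).

Lemma goeritz_reindex D X Y (s : 'I_n.+1 -> 'I_n.+1) :
    (forall i, Y i = X (s i)) -> injective s ->
  goeritz D xi Y = reindex_mx s *m goeritz D xi X *m (reindex_mx s)^T.
Proof.
move=> YE s_inj.
have entryE i j : goeritz_entry D xi Y i j = goeritz_entry D xi X (s i) (s j).
  have offE a b : goeritz_offdiag D xi Y a b
      = goeritz_offdiag D xi X (s a) (s b).
    by rewrite /goeritz_offdiag !YE.
  rewrite /goeritz_entry (inj_eq s_inj); case: eqP => // _.
  rewrite [in RHS](reindex_inj s_inj) /=; congr (- _).
  by apply: eq_big => k; rewrite ?(inj_eq s_inj) // => _; exact: offE.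
pose L := goeritz_entry D xi X.
(* When [k] is 0 the row of coefficients is constantly -1, and the vanishing sum of [f] recovers
   [f ord0] from the other values. *)
have elim_row (f : 'I_n.+1 -> int) (k : 'I_n.+1) : \sum_j f j = 0 ->
    \sum_(j < n) ((k == lift ord0 j)%:R - (k == ord0)%:R) * f (lift ord0 j)
      = f k.
  rewrite big_ord_recl => f_sum.
  under eq_bigr do rewrite mulrBl.
  rewrite sumrB -mulr_sumr.
  have -> : \sum_(j < n) f (lift ord0 j) = - f ord0.
    by apply/eqP; rewrite -addr_eq0 addrC f_sum.
  rewrite mulrN opprK.
  have [k' ->|->] := unliftP ord0 k; last first.
    by rewrite eqxx mul1r big1 ?add0r // => j _; rewrite mul0r.
  rewrite mul0r addr0 (bigD1 k') //= eqxx mul1r big1 ?addr0 // => j jk.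
  by rewrite (inj_eq lift_inj) eq_sym (negPf jk) mul0r.
(* [elim_row] is used once in each index; symmetry of the entries lets it act on both. *)
apply/matrixP => i j; rewrite mxE entryE mxE.
rewrite -/(L _ _) -(elim_row (L (s (lift ord0 i))));
  last exact: goeritz_entry_sum.
apply: eq_bigr => k _; rewrite mulrC; congr (_ * _); last by rewrite !mxE.
rewrite {1}/L goeritz_entryC -/(L _ _) -(elim_row (L (lift ord0 k)));
  last exact: goeritz_entry_sum.
by rewrite mxE; apply: eq_bigr => l _; rewrite !mxE /L goeritz_entryC.
Qed.

(** Each ordering is the other one composed with an injection of the indices, which yields the two
    congruences for [signature_congr]. *)
Lemma goeritz_ordering D X Y :
    white_ordering xi X -> white_ordering xi Y ->
  mx_signature (goeritz D xi X) = mx_signature (goeritz D xi Y) /\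
  mx_nullity (goeritz D xi X) = mx_nullity (goeritz D xi Y).
Proof.
move=> hX hY.
have transition Z T : white_ordering xi Z -> white_ordering xi T ->
    exists2 s : 'I_n.+1 -> 'I_n.+1, injective s & forall i, T i = Z (s i).
  move=> [_ onZ] [T_inj onT].
  have ex i : exists j, Z j == T i.
    by have /onZ[j <-] : ~~ black xi (T i) by [apply/onT; exists i]; exists j.
  exists (fun i => xchoose (ex i)) => [i j eq_ij|i]; last first.
    by rewrite (eqP (xchooseP (ex i))).
  apply: T_inj.
  by rewrite -(eqP (xchooseP (ex i))) eq_ij (eqP (xchooseP (ex j))).
have [s s_inj YE] := transition _ _ hX hY.
have [t t_inj XE] := transition _ _ hY hX.
apply: signature_congr; [exact: goeritz_sym | |]; exact: goeritz_reindex.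
Qed.

(** * Effect of a crossing change *)

Variables (D D' : diagram P) (c : crossing P).
Hypothesis hdiff : differ_only_at D D' c.

Lemma incidence_away c' : c' != c -> incidence D' xi c' = incidence D xi c'.
Proof. by case: hdiff => _ h /eqP c'c; rewrite !incidenceE h. Qed.

Lemma type_II_same c' : type_II D' xi c' = type_II D xi c'.
Proof. by case: hdiff => h _; rewrite !type_IIE !h. Qed.

Lemma mu_change :
  mu D' xi = mu D xi
    + (if type_II D xi c then incidence D' xi c - incidence D xi c else 0).
Proof.
rewrite /mu big_mkcond [in RHS]big_mkcond /= !(bigD1 c (P := xpredT)) //=.
rewrite type_II_same addrAC; congr (_ + _).
  by case: ifP; rewrite ?addr0 // addrC subrK.
by apply: eq_bigr => c' c'c; rewrite type_II_same incidence_away.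
Qed.

Lemma goeritz_offdiag_change X i j :
  goeritz_offdiag D' xi X i j = goeritz_offdiag D xi X i j
    - (if incident c (X i) && incident c (X j)
       then incidence D' xi c - incidence D xi c else 0).
Proof.
rewrite /goeritz_offdiag big_mkcond [in RHS]big_mkcond /=.
rewrite !(bigD1 c (P := xpredT)) //= -opprD; congr (- _).
rewrite addrAC; congr (_ + _).
  by case: ifP; rewrite ?addr0 // addrC subrK.
by apply: eq_bigr => c' c'c; rewrite incidence_away.
Qed.

(** For distinct regions the product of their [white_side] values is -1 if they are the two white
    regions at [c] and 0 otherwise, matching the sign in [goeritz_offdiag]. The diagonal follows
    because [white_side] sums to zero over all white regions. *)
Lemma goeritz_change X : white_ordering xi X ->
  let u : 'cV[int]_n := \col_i white_side xi c (X (lift ord0 i)) in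
  goeritz D' xi X = goeritz D xi X
    + (incidence D' xi c - incidence D xi c) *: (u *m u^T).
Proof.
move=> [X_inj onX] u; set d := incidence D' xi c - _.
pose a i := white_side xi c (X i).
have X_white i : ~~ black xi (X i) by apply/onX; exists i.
have [w1 w2] := white_sector_white xi c.
have a_sum : \sum_i a i = 0.
  have one r : ~~ black xi r -> \sum_i (X i == r)%:R = 1 :> int.
    move=> /onX[k <-]; rewrite (bigD1 k) //= eqxx big1 ?addr0 // => i ik.
    by rewrite (inj_eq X_inj) (negPf ik).
  by rewrite /a /white_side sumrB !one // subrr.
have offE i j : i != j -> goeritz_offdiag D' xi X i j
    = goeritz_offdiag D xi X i j + d * (a i * a j).
  move=> ij; rewrite goeritz_offdiag_change !(incident_white (xi := xi)) //.
  congr (_ + _).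
  rewrite /a /white_side -/d.
  have : ~~ [&& X i == corner (c, white_sector xi c)
          & X j == corner (c, white_sector xi c)].
    by apply: contra ij => /andP[/eqP <- /eqP /X_inj ->].
  have : ~~ [&& X i == corner (c, white_sector xi c + 2)
          & X j == corner (c, white_sector xi c + 2)].
    by apply: contra ij => /andP[/eqP <- /eqP /X_inj ->].
  (* If both white sectors lie in one region, [a] vanishes and two distinct regions cannot both be
     incident to [c]. *)
  have [ew|nw] := eqVneq (corner (c, white_sector xi c))
                      (corner (c, white_sector xi c + 2)).
    rewrite ew; case: (X i == _); case: (X j == _) => //= _ _; ring.
  have : ~~ [&& X i == corner (c, white_sector xi c)
          & X i == corner (c, white_sector xi c + 2)].
    by apply: contra nw => /andP[/eqP <- /eqP ->].
  have : ~~ [&& X j == corner (c, white_sector xi c)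
          & X j == corner (c, white_sector xi c + 2)].
    by apply: contra nw => /andP[/eqP <- /eqP ->].
  by do 4!case: (_ == _) => //=; move=> *; ring.
apply/matrixP => i j; rewrite !mxE big_ord1 !mxE -!/(a _).
move: (lift ord0 i) (lift ord0 j) => {}i {}j; rewrite /goeritz_entry.
have [<-|ij] := eqVneq i j; last exact: offE.
(* By [a_sum], the values [a k] with [k != i] add up to [- a i], so the diagonal correction is
   [d * (a i * a i)]. *)
rewrite (eq_bigr (fun k => goeritz_offdiag D xi X i k + d * (a i * a k))).
  rewrite big_split /= opprD; congr (_ + _).
  rewrite -!mulr_sumr -mulrN -mulrN; congr (_ * (_ * _)).
  by apply/eqP; rewrite eq_sym -addr_eq0; move: a_sum;
     rewrite (bigD1 i) //= => ->.
by move=> k ki; apply: offE; rewrite eq_sym.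
Qed.
End Goeritz.

Theorem theorem5p5 (P : projection) (Dplus Dminus : diagram P)
    (c : crossing P) (xi : coloring P)
    (n : nat) (X Y : 'I_n.+1 -> region P)
    (hconn : connected_projection P)
    (hdiff : differ_only_at Dplus Dminus c)
    (hplus : crossing_sign Dplus c = 1)
    (hminus : crossing_sign Dminus c = -1)
    (hX : white_ordering xi X) (hY : white_ordering xi Y) :
  (link_signature Dplus xi X <= link_signature Dminus xi Y
     <= link_signature Dplus xi X + 2)
  /\ (link_nullity Dplus xi X = link_nullity Dminus xi Y ->
        link_signature Dminus xi Y = link_signature Dplus xi X
        \/ link_signature Dminus xi Y = link_signature Dplus xi X + 2)
  /\ (link_nullity Dplus xi X <> link_nullity Dminus xi Y ->
        link_signature Dminus xi Y = link_signature Dplus xi X + 1).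
Proof.
rewrite /link_signature /link_nullity (mu_change xi hdiff).
have [<- <-] := goeritz_ordering Dminus hX hY.
have := goeritz_change hdiff hX; set u := \col_i _ => /=.
rewrite !incidence_sign (type_II_same xi hdiff) hplus hminus.
case: ifP => _ GE.
(* In type II the rank-one term is negative, so the comparison runs from [Dminus] to [Dplus]. The
   drop of [mu] by 2 turns a signature difference [x] into [2 - x], which preserves the range from 0
   to 2 and the value 1. *)
- have {}GE : goeritz Dplus xi X = goeritz Dminus xi X + 2 *: (u *m u^T).
    by rewrite GE -addrA -scalerDl scale0r addr0.
  by have [] := signature_rank_one (goeritz_sym xi Dminus X) _ GE; lia.
- have [] := signature_rank_one (goeritz_sym xi Dplus X) _ GE; lia.
Qed.
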